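(* There exist a non-decreasing sequence of positive integers $(a_n)_{n\in\mathbb{N}}$ with $\lim_n a_n=\infty$ and a subshift $B\subseteq\{0,1\}^{\mathbb{Z}}$ such that $B$ is not a factor of any element of $\mathcal{Z}(a_n)$.
   Context: A shift (subshift) is a non-empty closed $\sigma$-invariant subset $X$ of $\mathcal{A}^{\mathbb{Z}}$, $\mathcal{A}$ any finite alphabet, where $(\sigma x)_n=x_{n+1}$. A minimal forbidden word of $X$ is a finite word over $\mathcal{A}$ that occurs in no element of $X$ but all of whose proper subwords occur in elements of $X$. For a non-decreasing sequence $(a_n)$ of positive integers with $\lim_n a_n=\infty$, $\mathcal{Z}(a_n)$ is the set of all shifts $(X,\sigma)$ such that, for infinitely many $n\in\mathbb{N}$, $X$ has no minimal forbidden words of length between $n$ and $n+a_n$ (inclusive). A shift $Y$ is a factor of a shift $X$ if there is a continuous surjection $\pi\colon X\to Y$ with $\pi\circ\sigma=\sigma\circ\pi$. *)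

(* Defs.v *)
From mathcomp Require Import all_boot all_order all_algebra.
From mathcomp Require Import all_classical topology.

Set Implicit Arguments.
Unset Strict Implicit.
Unset Printing Implicit Defensive.

Import GRing.Theory.

Local Open Scope classical_set_scope.

(* The alias [discrete_topology] is needed so that [A^Z] carries the product of
   the discrete topologies: a bare [finType] has no topology in the library. *)
Definition fullshift (A : finType) : topologicalType :=
  prod_topology (fun _ : int => discrete_topology A).

Definition shift (A : finType) (x : fullshift A) : fullshift A :=
  fun n : int => x (n + 1)%R.

(* [sigma]-invariance is [sigma X = X] (two-sided shift). *)
Definition subshift (A : finType) (X : set (fullshift A)) : Prop :=
  [/\ X !=set0, closed X & @shift A @` X = X].

Definition window (A : finType) (x : fullshift A) (i : int) (n : nat) : seq A :=
  [seq x (i + k%:Z)%R | k <- iota 0 n].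

Definition occurs_in (A : finType) (X : set (fullshift A)) (w : seq A) : Prop :=
  exists2 x, X x & exists i : int, window x i (size w) = w.

(* [infix u w]: [u] is a contiguous subword of [w]. *)
Definition minimal_forbidden (A : finType) (X : set (fullshift A))
    (w : seq A) : Prop :=
  ~ occurs_in X w /\ forall u : seq A, infix u w -> u != w -> occurs_in X u.

Definition Z_class (a : nat -> nat) (A : finType) (X : set (fullshift A)) :
    Prop :=
  subshift X /\
  infinite_set [set n : nat | forall w : seq A,
    n <= size w <= n + a n -> ~ minimal_forbidden X w].

(* A map [X -> Y] is encoded as a map on the whole full shift of which only the
   restriction to [X] matters; continuity is for the subspace topology. *)
Definition factor_of (A A' : finType) (Y : set (fullshift A'))
    (X : set (fullshift A)) : Prop :=
  exists pi : fullshift A -> fullshift A',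
    [/\ {within X, continuous pi},
        pi @` X = Y
      & forall x, X x -> pi (shift x) = shift (pi x)].

(* Main.v *)
Require Import Defs.
From mathcomp Require Import all_boot all_order all_algebra.
From mathcomp Require Import all_classical topology.
From mathcomp Require Import zify.

Local Open Scope classical_set_scope.

(** Let [B] be the shift of binary sequences containing no fifth power, that is
    no word of length [5 * p] with period [p > 0]; it is non-empty because it
    contains the period-doubling sequence.  It is not a factor of any shift [X]
    with long gaps in the lengths of its minimal forbidden words, for the
    following reason.

    If [X] has no minimal forbidden word of length between [n] and [n + g], then
    a word of length at most [n + g] all of whose subwords shorter than [n] occur
    in [X] occurs in [X] itself: a subword of it that does not occur and is
    shortest possible is minimal forbidden, so its length would fall in the gap
    ([gap_occurs]).  On the other hand, by the pigeonhole principle every point of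
    [X] has two equal windows of length [n] at some distance [p <= #|A| ^ n]
    ([repeated_window]).  Repeating the stretch between them periodically creates
    no new subword of length less than [n], so [X] contains a word of length
    [n + g] with period [p] ([gap_periodic_word]).

    A factor map is a sliding block code of some radius [r] ([local_rule]), hence
    it sends this word to a word with the same period [p] which is shorter only
    by about [2 * r].  If [g] is at least [5 * n.+1 ^ n.+1] and [n] is large
    compared with [r] and [#|A|], what remains has length at least [5 * p] and
    contains a fifth power, which [B] excludes ([gap_not_factor]).  As the gap
    condition holds for infinitely many [n], such a large [n] is always available,
    so [a n := 5 * n.+1 ^ n.+1] works for all alphabets and all factor maps at
    once. *)

Definition agree (A : finType) (r : nat) (x y : fullshift A) : Prop :=
  forall k : int, (`|k| < r)%N -> y k = x k.

Definition translate (A : finType) (i : int) (x : fullshift A) : fullshift A :=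
  fun n : int => x (n + i)%R.

(** * Cylinders and sliding block codes *)

Lemma nbhs_agree (A : finType) (r : nat) (x : fullshift A) :
  nbhs x (agree A r x).
Proof.
elim: r => [|r IH]; first by apply: filterS filterT => y _ k.
have coord (k : int) : nbhs x [set y : fullshift A | y k = x k].
  have := @proj_continuous int (fun=> discrete_topology A) k x.
  by move/(_ _ (discrete_set1 (x k))).
apply: filterS (filterI IH (filterI (coord (r%:Z)%R) (coord (- r%:Z)%R))).
move=> y [yx [yr yNr]] k kr.
have [kr'|] := ltnP `|k| r; first exact: yx.
by move=> rk; have [->|->] : k = (r%:Z)%R \/ k = (- r%:Z)%R by lia.
Qed.

(** The filter generated by the cylinders around [x] converges to [x] because it
    does so in every coordinate; in a topology of pointwise convergence nothing
    more is needed. *)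
Lemma nbhs_agree_sub (A : finType) (x : fullshift A) (U : set (fullshift A)) :
  nbhs x U -> exists r, agree A r x `<=` U.
Proof.
pose F : set_system (fullshift A) := filter_from setT (agree A ^~ x).
have FF : Filter F.
  apply: filter_from_filter; first by exists 0%N.
  move=> r s _ _; exists (maxn r s) => // y xy.
  by split=> k kr; apply: xy; rewrite leq_max kr ?orbT.
have: F --> x.
  apply/cvg_sup => k V [W [[O oO OW] Wx] WV].
  exists (`|k|.+1) => // y xy; apply: WV; rewrite -OW /= xy ?ltnSn //.
  by move: Wx; rewrite -OW.
by move=> + xU => /(_ U xU) [r _ rU]; exists r.
Qed.

Lemma fullshift_compact (A : finType) : compact [set: fullshift A].
Proof.
have := @tychonoff int (fun=> discrete_topology A) (fun=> setT).
move=> /(_ _)/wrap[].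
  by move=> _; apply: finite_compact; exact: finite_finset.
by congr compact; apply/seteqP; split.
Qed.

(** The Curtis-Hedlund-Lyndon theorem, reduced to coordinate [0].  Continuity
    gives a radius around each point of [X]; compactness makes it uniform. *)
Lemma local_rule (A A' : finType) (X : set (fullshift A))
    (pi : fullshift A -> fullshift A') :
  closed X -> {within X, continuous pi} ->
  exists r, forall x y, X x -> X y -> agree A r x y -> pi x 0%R = pi y 0%R.
Proof.
move=> Xcl /subspace_continuousP picont.
have Xco : compact X by apply: subclosed_compact Xcl (fullshift_compact A) _.
have [|r _ rP] := iffLR (compact_near_coveringP _) Xco nat \oo
    (fun r x => forall y, X x -> X y -> agree A r x y -> pi x 0%R = pi y 0%R)
    _.
  move=> x Xx.
  have [r0 r0P] : exists r, agree A r x `<=`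
      [set y | X y -> pi y 0%R = pi x 0%R].
    apply: nbhs_agree_sub.
    have nbhs_pi := picont x Xx _ (nbhs_agree A' 1 (pi x)).
    by apply: (@filterS _ (nbhs x) _ _ _ _ nbhs_pi) => y piy /piy; exact.
  exists (agree A r0 x, [set r | r0 <= r]%N) => /=.
    by split; [exact: nbhs_agree|exists r0].
  move=> [x' r] /= [xx' rr] y Xx' Xy x'y.
  rewrite (r0P _ xx' Xx') (r0P y) // => k kr.
  by rewrite x'y ?xx' //; exact: leq_trans rr.
exists r => x y Xx Xy; exact: (rP r (leqnn r)).
Qed.

(** * Translates by integers *)

Lemma translate_in (A : finType) (X : set (fullshift A)) (x : fullshift A) i :
  subshift X -> X x -> X (translate A i x).
Proof.
move=> [_ _ Xinv] Xx; elim/int_rect: i => [|n IH|n IH].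
- rewrite (_ : translate _ _ _ = x)//.
  by apply/funext => k; rewrite /translate GRing.addr0.
- rewrite -Xinv; exists (translate A n x) => //; apply/funext => k.
  by rewrite /shift /translate; congr x; lia.
- move: IH; rewrite -{1}Xinv => -[y Xy yx].
  rewrite (_ : translate _ _ _ = y)//; apply/funext => k.
  have := congr1 (fun z => z (k - 1)%R) yx; rewrite /shift /translate.
  by rewrite (_ : k - 1 + 1 = k)%R => [->|]; [congr x|]; lia.
Qed.

Lemma commute_translate (A A' : finType) (X : set (fullshift A))
    (pi : fullshift A -> fullshift A') (x : fullshift A) i :
  subshift X -> (forall y, X y -> pi (shift y) = shift (pi y)) -> X x ->
  pi (translate A i x) = translate A' i (pi x).
Proof.
move=> Xsub pishift Xx; have Xtr j := translate_in A X x j Xsub Xx.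
have trS (B : finType) (z : fullshift B) j :
    translate B (j + 1)%R z = shift (translate B j z).
  by apply/funext => k; rewrite /shift /translate; congr z; lia.
elim/int_rect: i => [|n IH|n IH].
- rewrite (_ : translate _ _ _ = x)//; last first.
    by apply/funext => k; rewrite /translate GRing.addr0.
  by apply/funext => k; rewrite /translate GRing.addr0.
- by rewrite -addn1 PoszD !trS pishift // IH.
- have := pishift _ (Xtr (- n.+1%:Z)%R); rewrite -trS.
  rewrite (_ : - n.+1%:Z + 1 = - n%:Z)%R; last lia.
  rewrite IH => e; apply/funext => k.
  have := congr1 (fun z => z (k - 1)%R) e; rewrite /shift /translate.
  by rewrite (_ : k - 1 + 1 = k)%R => [<-|]; [congr (pi x)|]; lia.
Qed.

(** * Minimal forbidden words and periodic words *)

Lemma infix_map_iota (T : eqType) (f : nat -> T) (u : seq T) (L : nat) :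
  infix u [seq f k | k <- iota 0 L] ->
  exists m, u = [seq f k | k <- iota m (size u)].
Proof.
case/infixP => s [s' e]; exists (size s).
have Lsz : (size s + size u <= L)%N.
  have := congr1 size e; rewrite !size_cat size_map size_iota => ->.
  by rewrite addnA leq_addr.
have := congr1 (fun w => take (size u) (drop (size s) w)) e.
rewrite drop_size_cat // take_size_cat // -map_drop -map_take.
by rewrite drop_iota take_iota add0n (minn_idPl _) //; lia.
Qed.

(** A shortest subword of [w] that does not occur is minimal forbidden. *)
Lemma minimal_forbidden_infix (A : finType) (X : set (fullshift A))
    (w : seq A) :
  ~ occurs_in X w -> exists2 u, infix u w & minimal_forbidden X u.
Proof.
have [n] := ubnP (size w); elim: n w => // n IH w wn wX.
have [?|] := pselect (forall u, infix u w -> u != w -> occurs_in X u).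
  by exists w; first exact: infix_refl.
move/existsNP => [u /not_implyP[uw /not_implyP[uNw uX]]].
have szu : (size u < size w)%N.
  rewrite ltn_neqAle size_infix // andbT; apply: contra uNw => /eqP szu.
  case/infixP: uw szu => s [s' ->]; rewrite !size_cat => /eqP.
  (* An infix of full length leaves nothing on either side. *)
  by case: s s' => [|? ?] [|? ?] /=; rewrite ?cats0 // => /eqP; lia.
have [v vu vX] := IH u (leq_trans szu wn) uX.
by exists v => //; exact: infix_trans uw.
Qed.

(** Up to length [n + g], the language of a shift whose minimal forbidden words
    avoid the lengths from [n] to [n + g] coincides with that of the shift of
    finite type defined by its minimal forbidden words shorter than [n]. *)
Lemma gap_occurs (A : finType) (X : set (fullshift A)) (n g : nat) (w : seq A) :
  (forall v : seq A, n <= size v <= n + g -> ~ minimal_forbidden X v) ->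
  size w <= n + g ->
  (forall u, infix u w -> size u < n -> occurs_in X u) ->
  occurs_in X w.
Proof.
move=> gap wng short; apply: contrapT => /minimal_forbidden_infix[u uw uX].
have [nu|un] := leqP n (size u); last by case: uX => + _; apply; exact: short.
by apply: gap uX; rewrite nu (leq_trans (size_infix uw)).
Qed.

Lemma repeated_window (A : finType) (x : fullshift A) (n : nat) :
  exists (i : int) (p : nat), [/\ 0 < p, p <= #|A| ^ n
    & forall k, k < n -> x (i + (k + p)%N%:Z)%R = x (i + k%:Z)%R].
Proof.
pose f (i : 'I_(#|A| ^ n).+1) := [tuple x (i%:Z + (k : nat)%:Z)%R | k < n].
have /injectivePn[i [j ij fij]] : ~~ injectiveb f.
  apply/negP => /injectiveP /leq_card.
  by rewrite card_ord card_tuple ltnn.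
wlog ltij : i j ij fij / i < j.
  move=> H; have [ltij|ltji|e] := ltngtP i j; first exact: (H i j).
    by apply: (H j i) => //; rewrite eq_sym.
  by case/negP: ij; apply/eqP/val_inj.
exists i%:Z%R, (j - i)%N; split; first by rewrite subn_gt0.
  by rewrite (leq_trans (leq_subr _ _)) // -ltnS.
move=> k kn; have := congr1 (fun t => tnth t (Ordinal kn)) fij.
rewrite !tnth_mktuple /= => ->.
by rewrite -!PoszD addnCA subnKC 1?[(k + _)%N]addnC // ltnW.
Qed.

(** The [n] coincidences at distance [p] make the first [n + p] terms
    [p]-periodic, even when [n] is much smaller than [p]. *)
Lemma periodic_extend (T : Type) (x : nat -> T) (p n m : nat) :
  (forall k, k < n -> x (k + p) = x k) -> m < n + p -> x m = x (m %% p).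
Proof.
move=> per; have [->|p0] := posnP p; first by rewrite modn0.
have [M] := ubnP m; elim: M m => // M IH m mM mnp.
have [mp|pm] := ltnP m p; first by rewrite modn_small.
rewrite -{1}(subnK pm) per; last lia.
by rewrite IH; [rewrite -{2}(subnK pm) modnDr|lia|lia].
Qed.

(** The word obtained is the periodic repetition of the stretch of length [p]
    between the starts of two equal windows of length [n].  A subword of it
    shorter than [n] starts in some copy of the stretch and may run into later
    ones; it is still read in the original point, starting in the stretch, because
    the second window continues the period. *)
Lemma gap_periodic_word (A : finType) (X : set (fullshift A)) (n g : nat) :
  subshift X ->
  (forall v : seq A, n <= size v <= n + g -> ~ minimal_forbidden X v) ->
  exists (p : nat) (z : fullshift A), [/\ 0 < p, p <= #|A| ^ n, X z
    & forall k, k + p < n + g -> z (k + p)%N%:Z%R = z k%:Z%R].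
Proof.
move=> Xsub gap; have [[x Xx] _ _] := Xsub.
have [i [p [p0 pn per]]] := repeated_window A x n.
pose f k := x (i + (k %% p)%N%:Z)%R.
have [|u uf un|y Xy [j]] :=
  gap_occurs A X n g [seq f k | k <- iota 0 (n + g)] gap.
- by rewrite size_map size_iota.
- have [m um] := infix_map_iota _ _ _ _ uf.
  exists x => //; exists (i + (m %% p)%N%:Z)%R.
  rewrite {2}um -[m in RHS]addn0 iotaDl -map_comp; apply/eq_in_map => k.
  rewrite mem_iota add0n => /andP[_ ku].
  have := periodic_extend _ (fun k => x (i + k%:Z)%R) p n (m %% p + k) per.
  rewrite modnDml /f /= -GRing.addrA -PoszD => -> //.
  by have := ltn_pmod m p0; have := ltn_trans ku un; lia.
- rewrite size_map size_iota => /eq_in_map yf.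
  exists p, (translate A j y); split=> //; first exact: translate_in.
  have trf k : k < n + g -> translate A j y k%:Z%R = f k.
    by move=> kn; rewrite /translate GRing.addrC yf // mem_iota.
  by move=> k kn; rewrite !trf /f ?modnDr //; lia.
Qed.

(** * The shift of sequences without fifth powers *)

(** A word of length [5 * p] with period [p] amounts to [4 * p] consecutive
    coincidences at distance [p], whence the bound on [l].  The condition for
    given [p] and [i] involves finitely many coordinates only, which makes the
    set closed. *)
Definition fifth_power_free : set (fullshift bool) :=
  [set x | forall (p : nat) (i : int), 0 < p ->
    exists2 l, l < 4 * p & x (i + l%:Z)%R <> x (i + (l + p)%N%:Z)%R].

(** The term at [m != 0] is the parity of the 2-adic valuation of [m]; the term
    at [0] is [false], as [logn 2 0 = 0]. *)
Definition period_doubling : fullshift bool :=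
  fun m : int => odd (logn 2 `|m|%N).

(** Let [d] be the largest power of [2] dividing [p].  Every block of [4 * d]
    integers contains an [m] with [m + p] congruent to [2 * d] modulo [4 * d].
    Then [m + p] has valuation one more than [d], while [m] is an odd multiple of
    [d], so the valuations of [m] and [m + p] have different parities. *)
Lemma period_doubling_fifth_power_free : fifth_power_free period_doubling.
Proof.
move=> p i p0; have [q qodd pE] := pfactor_coprime (erefl : prime 2) p0.
rewrite coprime2n in qodd; set k := logn 2 p in pE.
pose d := 2 ^ k.
have d0 : 0 < d by rewrite expn_gt0.
have tE (u : int) : odd `|u|%N -> logn 2 `|(d%:Z * u)%R|%N = k.
  by move=> uodd; rewrite abszM mulnC logn_Gauss ?coprime2n // pfactorK.
have tE2 (u : int) : odd `|u|%N -> logn 2 `|(d.*2%:Z * u)%R|%N = k.+1.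
  move=> uodd; rewrite abszM mulnC logn_Gauss ?coprime2n //.
  by rewrite -mul2n -expnS pfactorK.
(* [i + l] is the first integer from [i] on to be such an [m]. *)
pose c := (d.*2%:Z - p%:Z - i)%R; pose D := (4 * d)%:Z%R.
have D0 : D != 0%R by rewrite /D; lia.
have := divz_eq c D; have := modz_ge0 c D0; have := ltz_mod c D0.
set s := (c %/ D)%Z; set l := (c %% D)%Z => lD l0 cE.
have ltl : `|l|%N < 4 * d by lia.
have q0 : 0 < q by rewrite odd_gt0.
exists `|l|%N; first by rewrite pE -/d; nia.
have -> : (i + `|l|%N%:Z = d%:Z * (2 - 4 * s - q%:Z))%R.
  have pdq : p = q * d by []. nia.
have -> : (i + (`|l| + p)%N%:Z = d.*2%:Z * (1 - 2 * s))%R.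
  by rewrite /c /D in cE *; lia.
rewrite /period_doubling tE ?tE2 /=; [by case: odd | lia | lia].
Qed.

Lemma fifth_power_free_subshift : subshift fifth_power_free.
Proof.
have free_tr x i : fifth_power_free x -> fifth_power_free (translate bool i x).
  move=> xfree p j p0; have [l lp xl] := xfree p (j + i)%R p0; exists l => //.
  by rewrite /translate !(GRing.addrAC _ _ i).
split.
- by exists period_doubling; exact: period_doubling_fifth_power_free.
- move=> x xcl p i p0.
  have [y [yfree xy]] := xcl _ (nbhs_agree bool (`|i| + 5 * p) x).
  have [l lp yl] := yfree p i p0; exists l => //.
  by rewrite -!xy //; lia.
- apply/seteqP; split=> [_ [x xfree <-]|x xfree]; first exact: (free_tr x 1%R).
  exists (translate bool (- 1)%R x); first exact: free_tr.
  by apply/funext => k; rewrite /shift /translate GRing.addrK.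
Qed.

Lemma gap_not_factor (A : finType) (X : set (fullshift A)) (g : nat -> nat) :
  (forall n, 5 * n.+1 ^ n.+1 <= g n) -> Z_class g X ->
  ~ factor_of fifth_power_free X.
Proof.
move=> gbig [Xsub Xgap] [pi [picont piX pishift]].
have [_ Xcl _] := Xsub.
have [r rP] := local_rule A _ X pi Xcl picont.
(* [2 * r <= n] absorbs the loss of [r] letters at both ends of the word, and
   [#|A| <= n] bounds the period [#|A| ^ n] independently of the alphabet. *)
have [n [ngap nbig]] : exists n, (forall w : seq A,
    n <= size w <= n + g n -> ~ minimal_forbidden X w) /\ 2 * r + #|A| <= n.
  apply: contrapT => noN; apply: Xgap.
  apply: sub_finite_set (finite_II (2 * r + #|A|)) => n /= ngap.
  by rewrite ltnNge; apply/negP => nbig; apply: noN; exists n.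
have [p [z [p0 pn Xz per]]] := gap_periodic_word A X n (g n) Xsub ngap.
have {}pn : 5 * p <= g n.
  apply: leq_trans (gbig n); rewrite leq_mul2l /= (leq_trans pn) //.
  apply: (@leq_trans (n.+1 ^ n)); last by rewrite leq_pexp2l.
  by case: (n) nbig => // m; rewrite leq_exp2r //; lia.
have piz : fifth_power_free (pi z) by rewrite -piX; exists z.
(* Coincidences are read from position [r] on, so that the windows of radius [r]
   stay inside the positions from [0] on where [z] has period [p]. *)
have [l lp] := piz p r%:Z%R p0; apply.
have piE k : pi z k = pi (translate A k z) 0%R.
  by rewrite (commute_translate _ _ X) // /translate GRing.add0r.
rewrite !piE; apply: rP; [exact: translate_in|exact: translate_in|].
move=> k kr; rewrite /translate.
have -> : (k + (r%:Z + l%:Z) = `|(k + (r%:Z + l%:Z))%R|%N%:Z)%R by lia.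
have -> :
  (k + (r%:Z + (l + p)%N%:Z) = (`|(k + (r%:Z + l%:Z))%R|%N + p)%N%:Z)%R by lia.
by apply: per; lia.
Qed.

Theorem proposition4p13 :
  exists (a : nat -> nat) (B : set (fullshift bool)),
    [/\ forall n, 0 < a n,
        {homo a : m n / m <= n},
        a n @[n --> \oo] --> \oo,
        subshift B
      & forall (A : finType) (X : set (fullshift A)),
          Z_class a X -> ~ factor_of B X].
Proof.
pose a n := 5 * n.+1 ^ n.+1.
have leqa n : n < a n.
  rewrite /a (@leq_trans (n.+1 ^ n.+1)) ?leq_pmull //.
  by rewrite -{1}(expn1 n.+1) leq_pexp2l.
exists a, fifth_power_free; split.
- by move=> n; exact: leq_ltn_trans (leqa n).
- move=> m n mn; rewrite /a leq_mul2l /=.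
  by apply: (@leq_trans (n.+1 ^ m.+1)); rewrite ?leq_exp2r ?leq_pexp2l.
- apply/cvgnyPge => N; exists N => // n /= Nn.
  exact: leq_trans Nn (ltnW (leqa n)).
- exact: fifth_power_free_subshift.
- by move=> A X; exact: gap_not_factor.
Qed.
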